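(* Let $m_0\ge1$, $p=2+m_0$, let $X\in\mathbb{R}^{n\times p}$ be a fair design with $X_1^TX_2=-\hat\rho$, $0<\hat\rho<1$, $\hat\varphi^2:=1-\hat\rho$, and let $\beta^0\in\mathbb{R}^p$ have active set $S_0=\{1,2\}$, so $S_0^c=\{3,\ldots,2+m_0\}$. Suppose $$X_{2+k}=C_k(X_1+X_2)/2+U_k,\quad k=1,\ldots,m_0,$$ where, for $k=1,\ldots,m_0$, the constant $C_k$ satisfies $C_k>1$ and $C_k^2\hat\varphi^2/2<1$, and the vector $U_k$ is orthogonal to $\{X_1,X_2,\{U_j\}_{j\ne k}\}$. For each $k\in\{1,\ldots,m_0\}$ let $\hat\tau_k^2:=1-C_k^2\hat\varphi^2/2$. Then $$\hat\Gamma^2(S_0)=\frac{2}{\hat\varphi^2}+\sum_{k=1}^{m_0}\frac{C_k^2}{\hat\tau_k^2}.$$ Moreover, if $\lambda>0$ and $\beta_1^0\ge\beta_2^0\ge\lambda/\hat\varphi^2+\lambda\sum_{k=1}^{m_0}C_k(C_k-1)/(2\hat\tau_k^2)$, the noiseless Lasso $\beta^*$ satisfies $$\|X(\beta^*-\beta^0)\|_2^2+2\lambda\|\beta_{-S_0}^*\|_1=\lambda^2\hat\Gamma^2(S_0)-\lambda^2\|1/\hat\tau^2\|_1.$$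
   Context: Fair design: all columns satisfy $\|X_j\|_2=1$ and there are no $j\ne k$ and constant $b$ with $X_j=bX_k$. The noiseless Lasso is $\beta^*:=\arg\min_{\beta\in\mathbb{R}^p}\{\|X(\beta-\beta^0)\|_2^2+2\lambda\|\beta\|_1\}$. Here $\|1/\hat\tau^2\|_1:=\sum_{k=1}^{m_0}1/\hat\tau_k^2$. For $S\subset\{1,\ldots,p\}$, $\beta_S$ is the vector with entries $\beta_j$ for $j\in S$ and $0$ otherwise, and $\beta_{-S}:=\beta_{S^c}$. The compatibility constant is $\hat\phi^2(S):=\min\{|S|\,\|X\beta\|_2^2:\ \|\beta_S\|_1=1,\ \|\beta_{-S}\|_1\le1\}$, and the effective sparsity is $\hat\Gamma^2(S):=|S|/\hat\phi^2(S)$. *)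

(* Defs.v *)
From HB Require Import structures.
From mathcomp Require Import all_boot all_order all_algebra.
From mathcomp Require Import all_classical all_reals.

Set Implicit Arguments.
Unset Strict Implicit.
Unset Printing Implicit Defensive.

Import Order.TTheory GRing.Theory Num.Theory.
Local Open Scope ring_scope.
Local Open Scope classical_set_scope.

Definition dot (R : realType) (n : nat) (u v : 'cV[R]_n) : R :=
  (u^T *m v) 0 0.

(* The library norm on matrices is the sup norm, hence the explicit
   Euclidean and l1 norms. *)
Definition norm2 (R : realType) (n : nat) (u : 'cV[R]_n) : R :=
  Num.sqrt (dot u u).

Definition norm1 (R : realType) (n : nat) (u : 'cV[R]_n) : R :=
  \sum_i `|u i 0|.

Definition fair_design (R : realType) (n p : nat) (X : 'M[R]_(n, p)) : Prop :=
  (forall j, norm2 (col j X) = 1) /\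
  ~ (exists j k (b : R), j != k /\ col j X = b *: col k X).

Definition subvec (R : realType) (p : nat) (S : {set 'I_p})
    (beta : 'cV[R]_p) : 'cV[R]_p :=
  \col_j (if j \in S then beta j 0 else 0).

Definition active_set (R : realType) (p : nat) (beta : 'cV[R]_p) :
    {set 'I_p} :=
  [set j | beta j 0 != 0]%SET.

(* The minimum (an attained lower bound) of A. It is 0 by convention when A has
   no minimum, so an equation between a nonzero value and a minimum entails
   that the minimum is attained. *)
Definition minimum (R : realType) (A : set R) : R := xget 0 (A `&` lbound A).

Definition compat2 (R : realType) (n p : nat) (X : 'M[R]_(n, p))
    (S : {set 'I_p}) : R :=
  minimum [set #|S|%:R * norm2 (X *m beta) ^+ 2 | beta in
    [set beta : 'cV[R]_p | norm1 (subvec S beta) = 1 /\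
                           norm1 (subvec (~: S)%SET beta) <= 1]].

(* Since x / 0 = 0 here, the value is 0, not infinity, if compat2 X S = 0. *)
Definition eff_sparsity2 (R : realType) (n p : nat) (X : 'M[R]_(n, p))
    (S : {set 'I_p}) : R :=
  #|S|%:R / compat2 X S.

Definition lasso_objective (R : realType) (n p : nat) (X : 'M[R]_(n, p))
    (beta0 : 'cV[R]_p) (lambda : R) (beta : 'cV[R]_p) : R :=
  norm2 (X *m (beta - beta0)) ^+ 2 + 2 * lambda * norm1 beta.

Definition noiseless_lasso (R : realType) (n p : nat) (X : 'M[R]_(n, p))
    (beta0 : 'cV[R]_p) (lambda : R) (betastar : 'cV[R]_p) : Prop :=
  forall beta, lasso_objective X beta0 lambda betastar <=
               lasso_objective X beta0 lambda beta.

(* The 1-based indices 1, 2 and 2 + k of {1, ..., 2 + m0}; the index k of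
   {1, ..., m0} is represented by an element of 'I_m0. *)
Definition idx1 (m0 : nat) : 'I_(2 + m0) := lshift m0 (0 : 'I_2).
Definition idx2 (m0 : nat) : 'I_(2 + m0) := lshift m0 (1 : 'I_2).
Definition idx2D (m0 : nat) (k : 'I_m0) : 'I_(2 + m0) := rshift 2 k.

Definition S0 (m0 : nat) : {set 'I_(2 + m0)} := [set idx1 m0; idx2 m0]%SET.

(* Main.v *)
(** Put [m = (X_1 + X_2) / 2] and [d = (X_1 - X_2) / 2]: the vectors
    [m, d, U_1, ..., U_m0] are orthogonal, so that, with [g_k = beta_(2+k)],
    [||X beta||^2 = (beta_1 + beta_2 + sum_k C_k g_k)^2 phi / 2
       + (beta_1 - beta_2)^2 (1 + rho) / 2 + sum_k tau_k g_k^2].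
    Minimizing under [|beta_1| + |beta_2| = 1] is a weighted Cauchy-Schwarz
    inequality when [beta_1] and [beta_2] have the same sign; opposite signs are
    never better because [1 + rho > phi].  The Cauchy-Schwarz minimizer
    satisfies the l1 constraint because [C_k > 1].
    For the Lasso, the lower bound on [beta^0_2] makes nonnegative the vector
    solving [X_j^T X (beta^0 - beta) = lambda] for every [j]; it is therefore a
    KKT point, and it is the only minimizer because the quadratic form is
    definite. *)
Require Import Defs.
From HB Require Import structures.
From mathcomp Require Import all_boot all_order all_algebra.
From mathcomp Require Import all_classical all_reals.
From mathcomp Require Import ring lra.

Set Implicit Arguments.
Unset Strict Implicit.
Unset Printing Implicit Defensive.

Import Order.TTheory GRing.Theory Num.Theory.
Local Open Scope ring_scope.

(** * Euclidean inner product and Pythagoras *)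

Section Dot.
Variables (R : realType) (n : nat).
Implicit Types u v w : 'cV[R]_n.

Lemma dotE u v : dot u v = \sum_i u i 0 * v i 0.
Proof. by rewrite /dot mxE; apply: eq_bigr => i _; rewrite mxE. Qed.

Lemma dotC u v : dot u v = dot v u.
Proof. by rewrite !dotE; apply: eq_bigr => i _; rewrite mulrC. Qed.

Lemma dotDl u v w : dot (u + v) w = dot u w + dot v w.
Proof. by rewrite /dot linearD mulmxDl mxE. Qed.

Lemma dotZl (a : R) u v : dot (a *: u) v = a * dot u v.
Proof. by rewrite /dot linearZ /= -scalemxAl mxE. Qed.

Lemma dot_suml (I : finType) (F : I -> 'cV[R]_n) v :
  dot (\sum_i F i) v = \sum_i dot (F i) v.
Proof. by rewrite /dot linear_sum mulmx_suml summxE. Qed.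

Lemma dotDr u v w : dot u (v + w) = dot u v + dot u w.
Proof. by rewrite !(dotC u) dotDl. Qed.

Lemma dotZr (a : R) u v : dot u (a *: v) = a * dot u v.
Proof. by rewrite !(dotC u) dotZl. Qed.

Lemma norm2_sqr u : norm2 u ^+ 2 = dot u u.
Proof.
rewrite /norm2 sqr_sqrtr // dotE sumr_ge0 // => i _.
by rewrite -expr2 sqr_ge0.
Qed.

Lemma dotDD u v : dot u v = 0 -> dot (u + v) (u + v) = dot u u + dot v v.
Proof. by move=> uv; rewrite dotDl !dotDr (dotC v) uv; ring. Qed.

Lemma dot_sum_orthogonal (I : finType) (c : I -> R) (U : I -> 'cV[R]_n) :
    (forall k j, j != k -> dot (U k) (U j) = 0) ->
  dot (\sum_k c k *: U k) (\sum_k c k *: U k) =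
  \sum_k dot (U k) (U k) * c k ^+ 2.
Proof.
move=> UU; rewrite dot_suml; apply: eq_bigr => k _.
rewrite dotZl dotC dot_suml (bigD1 k) //= big1 ?addr0; last first.
  by move=> j jk; rewrite dotZl dotC UU // mulr0.
by rewrite dotZl; ring.
Qed.

End Dot.

(** * Splitting coordinates into the active pair and the [m0] others *)

Section Coordinates.
Variables (R : realType) (m0 : nat).
Implicit Types beta : 'cV[R]_(2 + m0).

Lemma big_idx (V : nmodType) (F : 'I_(2 + m0) -> V) :
  \sum_i F i = F (idx1 m0) + F (idx2 m0) + \sum_k F (idx2D k).
Proof.
rewrite big_split_ord /= !big_ord_recl big_ord0 addr0.
by congr (F (lshift _ _) + F (lshift _ _) + _); apply/val_inj.
Qed.

Lemma idx_ind (P : 'I_(2 + m0) -> Prop) :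
  P (idx1 m0) -> P (idx2 m0) -> (forall k, P (idx2D k)) -> forall j, P j.
Proof.
move=> P1 P2 P2D j.
case: (split_ordP j) => [[[|[|//]] lt2]|k] ->; last exact: P2D.
- by have -> : Ordinal lt2 = 0 by apply: val_inj.
- by have -> : Ordinal lt2 = 1 by apply: val_inj.
Qed.

Lemma idx1_S0 : idx1 m0 \in S0 m0.
Proof. by rewrite !inE eqxx. Qed.

Lemma idx2_S0 : idx2 m0 \in S0 m0.
Proof. by rewrite !inE eqxx orbT. Qed.

Lemma idx2D_S0 (k : 'I_m0) : (idx2D k \in S0 m0) = false.
Proof. by rewrite !inE !eq_rlshift. Qed.

Lemma card_S0 : #|S0 m0| = 2%N.
Proof. by rewrite /S0 cards2 /idx1 /idx2 eq_lshift. Qed.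

Lemma norm1_subvec_S0 beta :
  norm1 (subvec (S0 m0) beta) = `|beta (idx1 m0) 0| + `|beta (idx2 m0) 0|.
Proof.
rewrite /norm1 big_idx !mxE idx1_S0 idx2_S0 big1 ?addr0 // => k _.
by rewrite mxE idx2D_S0 normr0.
Qed.

Lemma norm1_subvec_S0C beta :
  norm1 (subvec (~: S0 m0)%SET beta) = \sum_k `|beta (idx2D k) 0|.
Proof.
rewrite /norm1 big_idx !mxE !finset.in_setC idx1_S0 idx2_S0 normr0 !add0r.
by apply: eq_bigr => k _; rewrite mxE finset.in_setC idx2D_S0.
Qed.

Definition idx_col (a b : R) (g : 'I_m0 -> R) : 'cV[R]_(2 + m0) :=
  col_mx (\col_(i < 2) (if i == 0 then a else b)) (\col_k g k).

Lemma idx_col1 a b g : idx_col a b g (idx1 m0) 0 = a.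
Proof. by rewrite /idx_col /idx1 col_mxEu mxE eqxx. Qed.

Lemma idx_col2 a b g : idx_col a b g (idx2 m0) 0 = b.
Proof. by rewrite /idx_col /idx2 col_mxEu mxE. Qed.

Lemma idx_col2D a b g k : idx_col a b g (idx2D k) 0 = g k.
Proof. by rewrite /idx_col /idx2D col_mxEd mxE. Qed.

End Coordinates.

(** Writing [t] as [(t + S) - S] with [S = \sum_k C k * g k] makes it a combination of the variables
    squared on the right; Cauchy-Schwarz with weights [h] and [tau k] applies. *)
Lemma weighted_cauchy_schwarz (R : realFieldType) (I : finType) (h t : R)
    (tau C g : I -> R) :
    0 < h -> (forall k, 0 < tau k) ->
  t ^+ 2 / (h^-1 + \sum_k C k ^+ 2 / tau k) <=
  h * (t + \sum_k C k * g k) ^+ 2 + \sum_k tau k * g k ^+ 2.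
Proof.
move=> h0 tau0; set A := \sum_k C k ^+ 2 / tau k; set B := h^-1 + A.
have B0 : 0 < B.
  rewrite ltr_pwDl ?invr_gt0 // sumr_ge0 // => k _.
  by rewrite divr_ge0 ?sqr_ge0 // ltW.
set y := t / B; set S := \sum_k C k * g k.
(* AM-GM with the multiplier y, which attains equality at the optimum *)
have sumle : - 2 * y * S - y ^+ 2 * A <= \sum_k tau k * g k ^+ 2.
  rewrite /S /A !mulr_sumr -sumrB; apply: ler_sum => k _; rewrite -subr_ge0.
  have -> : tau k * g k ^+ 2 -
      (- 2 * y * (C k * g k) - y ^+ 2 * (C k ^+ 2 / tau k)) =
      (tau k * g k + y * C k) ^+ 2 / tau k by field; rewrite gt_eqF.
  by rewrite divr_ge0 ?sqr_ge0 // ltW.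
have hle : 2 * y * (t + S) - y ^+ 2 / h <= h * (t + S) ^+ 2.
  rewrite -subr_ge0.
  have -> : h * (t + S) ^+ 2 - (2 * y * (t + S) - y ^+ 2 / h) =
      (h * (t + S) - y) ^+ 2 / h by field; rewrite gt_eqF.
  by rewrite divr_ge0 ?sqr_ge0 // ltW.
apply: le_trans (lerD hle sumle).
suff -> : 2 * y * (t + S) - y ^+ 2 / h + (- 2 * y * S - y ^+ 2 * A) =
    t ^+ 2 / B by [].
transitivity (2 * y * t - y ^+ 2 * B); first by rewrite /B; ring.
by rewrite /y; field; rewrite gt_eqF.
Qed.

Lemma minimumP (R : realType) (A : set R) (x : R) :
  A x -> lbound A x -> minimum A = x.
Proof.
move=> Ax xA; rewrite /minimum; case: xgetP => [y _ [Ay yA]|/(_ x)].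
  by apply/eqP; rewrite eq_le yA // xA.
by case.
Qed.

(** * The quadratic form of the design and its compatibility constant *)

Section Design.
Variables (R : realType) (n m0 : nat) (X : 'M[R]_(n, 2 + m0)).
Variables (rho : R) (C tau : 'I_m0 -> R) (U : 'I_m0 -> 'cV[R]_n).
Hypotheses (unitX : forall j, norm2 (col j X) = 1)
  (hrho : dot (col (idx1 m0) X) (col (idx2 m0) X) = - rho)
  (rho0 : 0 < rho) (rho1 : rho < 1)
  (hXU : forall k, col (idx2D k) X =
     C k *: (2^-1 *: (col (idx1 m0) X + col (idx2 m0) X)) + U k)
  (hC1 : forall k, 1 < C k)
  (hU1 : forall k, dot (U k) (col (idx1 m0) X) = 0)
  (hU2 : forall k, dot (U k) (col (idx2 m0) X) = 0)
  (hUU : forall k j : 'I_m0, j != k -> dot (U k) (U j) = 0)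
  (htau : forall k, tau k = 1 - C k ^+ 2 * (1 - rho) / 2)
  (tau0 : forall k, 0 < tau k).

(** [h] and [g] are the squared norms of the half-sum and half-difference of the two active columns.
    [tau k] already denotes the square of tau_k, and [h^-1 + A] will be the effective sparsity. *)
Let h : R := (1 - rho) / 2.
Let g : R := (1 + rho) / 2.
Let A : R := \sum_k C k ^+ 2 / tau k.

Let h0 : 0 < h. Proof. by rewrite divr_gt0 ?subr_gt0. Qed.
Let hg : h <= g.
Proof. by rewrite ler_pM2r ?invr_gt0 // lerD2l ge0_cp // ltW. Qed.
Let g0 : 0 < g. Proof. exact: lt_le_trans hg. Qed.
Let A0 : 0 <= A.
Proof. by rewrite sumr_ge0 // => k _; rewrite divr_ge0 ?sqr_ge0 // ltW. Qed.

Lemma sqr_norm2_design (beta : 'cV[R]_(2 + m0)) :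
  norm2 (X *m beta) ^+ 2 =
  h * (beta (idx1 m0) 0 + beta (idx2 m0) 0
       + \sum_k C k * beta (idx2D k) 0) ^+ 2
  + g * (beta (idx1 m0) 0 - beta (idx2 m0) 0) ^+ 2
  + \sum_k tau k * beta (idx2D k) 0 ^+ 2.
Proof.
set X1 := col (idx1 m0) X; set X2 := col (idx2 m0) X.
set b1 := beta _ 0; set b2 := beta (idx2 m0) 0.
set s := b1 + b2 + \sum_k _.
have d11 : dot X1 X1 = 1 by rewrite -norm2_sqr unitX expr1n.
have d22 : dot X2 X2 = 1 by rewrite -norm2_sqr unitX expr1n.
have d12 : dot X1 X2 = - rho by exact: hrho.
have d21 : dot X2 X1 = - rho by rewrite dotC.
pose m := 2^-1 *: (X1 + X2); pose d := 2^-1 *: (X1 + (-1) *: X2).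
have dmm : dot m m = h.
  by rewrite /m !(dotZl, dotZr, dotDl, dotDr) d11 d22 d12 d21 /h; field.
have ddd : dot d d = g.
  by rewrite /d !(dotZl, dotZr, dotDl, dotDr) d11 d22 d12 d21 /g; field.
have dmd : dot m d = 0.
  by rewrite /m /d !(dotZl, dotZr, dotDl, dotDr) d11 d22 d12 d21; ring.
have dUm k : dot (U k) m = 0.
  by rewrite /m dotZr dotDr hU1 hU2 addr0 mulr0.
have dUd k : dot (U k) d = 0.
  by rewrite /d dotZr dotDr dotZr hU1 hU2 mulr0 addr0 mulr0.
(* The unit norm of column [idx2D k] determines that of [U k]: Pythagoras gives
   [1 = C k ^+ 2 * h + dot (U k) (U k)]. *)
have dUU k : dot (U k) (U k) = tau k.
  have := unitX (idx2D k) => /(congr1 (fun x => x ^+ 2)).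
  rewrite norm2_sqr expr1n hXU -/X1 -/X2 -/m dotDD; last first.
    by rewrite dotZl dotC dUm mulr0.
  rewrite dotZl dotZr dmm => unitXk; apply: (addrI (C k * (C k * h))).
  by rewrite unitXk htau /h; field.
(* The active columns are [m + d] and [m - d], and column [idx2D k] is [C k *: m + U k]. *)
have -> : X *m beta =
    s *: m + (b1 - b2) *: d + \sum_k beta (idx2D k) 0 *: U k.
  have -> : X *m beta = \sum_j beta j 0 *: col j X.
    apply/colP => i; rewrite mxE summxE; apply: eq_bigr => j _.
    by rewrite !mxE mulrC.
  rewrite big_idx -/X1 -/X2 -/b1 -/b2.
  under eq_bigr => k _ do rewrite hXU -/X1 -/X2 -/m scalerDr scalerA.
  rewrite big_split /= -scaler_suml addrA; congr (_ + _).
  rewrite /s; under [in RHS]eq_bigr => k _ do rewrite mulrC.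
  by apply/colP => i; rewrite !mxE; field.
rewrite norm2_sqr dotDD; last first.
  rewrite dotC dot_suml big1 // => k _.
  by rewrite dotZl dotDr (dotZr s) (dotZr (b1 - b2)) dUm dUd !mulr0 addr0 mulr0.
rewrite dotDD; last by rewrite (dotZl s) (dotZr (b1 - b2)) dmd !mulr0.
rewrite dot_sum_orthogonal // (dotZl s) (dotZr s) (dotZl (b1 - b2)).
rewrite (dotZr (b1 - b2)) dmm ddd.
under eq_bigr => k _ do rewrite dUU.
by congr (_ + _); ring.
Qed.

Lemma compat2_design : compat2 X (S0 m0) = 2 / (h^-1 + A).
Proof.
have B0 : 0 < h^-1 + A by rewrite ltr_pwDl ?invr_gt0.
apply: minimumP => /=.
(* [s] is the optimal value of [1 + \sum_k C k * g_k]. Stationarity in [g_k] reads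
   [h * s * C k + tau k * g_k = 0], which gives the witness below and then [s = 1 - h * s * A].
   Equal active coefficients cancel the difference term. *)
- pose s := (1 + h * A)^-1.
  have hA0 : 0 < 1 + h * A by rewrite ltr_pwDl // mulr_ge0 // ltW.
  exists (idx_col 2^-1 2^-1 (fun k => - (h * s * C k / tau k))); last first.
    rewrite card_S0 sqr_norm2_design idx_col1 idx_col2.
    under eq_bigr => k _ do rewrite idx_col2D.
    under [X in _ + _ + X]eq_bigr => k _ do rewrite idx_col2D.
    have -> : \sum_k C k * - (h * s * C k / tau k) = - (h * s * A).
      rewrite /A mulr_sumr -sumrN; apply: eq_bigr => k _; ring.
    have -> : \sum_k tau k * (- (h * s * C k / tau k)) ^+ 2 =
        (h * s) ^+ 2 * A.
      rewrite /A mulr_sumr; apply: eq_bigr => k _.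
      by field; rewrite gt_eqF.
    rewrite /s; field.
    by rewrite !gt_eqF // mulrC.
  split.
    rewrite norm1_subvec_S0 idx_col1 idx_col2 ger0_norm ?invr_ge0 //; lra.
  rewrite norm1_subvec_S0C.
  under eq_bigr => k _ do rewrite idx_col2D.
  have hs0 : 0 < h * s by apply: mulr_gt0 => //; rewrite invr_gt0.
  (* [C k <= C k ^+ 2] bounds the l1 norm by [h * A / (1 + h * A)], which is below 1. *)
  apply: (@le_trans _ _ (h * s * A)).
    rewrite /A mulr_sumr; apply: ler_sum => k _.
    have C0 : 0 < C k by exact: lt_trans (hC1 k).
    rewrite normrN ger0_norm; last first.
      by rewrite ltW // divr_gt0 // mulr_gt0.
    rewrite -mulrA ler_pM2l // ler_pM2r ?invr_gt0 //.
    by rewrite expr2 ler_peMl // ltW.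
  by rewrite mulrAC ler_pdivrMr // mul1r; lra.
- move=> _ [beta [b1 _] <-]; rewrite norm1_subvec_S0 in b1.
  rewrite card_S0 sqr_norm2_design ler_pM2l //.
  set a := beta (idx1 m0) 0 in b1 *; set b := beta (idx2 m0) 0 in b1 *.
  have := weighted_cauchy_schwarz (a + b) C (fun k => beta (idx2D k) 0) h0 tau0.
  rewrite -/A /=; set Q := \sum_k tau k * _; set P := h * _ => CS.
  (* The squared constraint is [(a + b) ^+ 2 = 1] for equal signs and [(a - b) ^+ 2 = 1] for
     opposite signs. *)
  have b1_sqr : a ^+ 2 + b ^+ 2 + 2 * `|a * b| = 1.
    rewrite -(real_normK (num_real a)) -(real_normK (num_real b)) normrM.
    transitivity ((`|a| + `|b|) ^+ 2); [ring | by rewrite b1 expr1n].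
  have [ab|ab] := leP 0 (a * b).
    have ab1 : (a + b) ^+ 2 = 1.
      by rewrite -b1_sqr (ger0_norm ab); ring.
    rewrite ab1 mul1r in CS; apply: le_trans CS _.
    by rewrite -addrA lerD2l lerDr mulr_ge0 ?sqr_ge0 // ltW.
  have ab1 : (a - b) ^+ 2 = 1.
    by rewrite -b1_sqr (ltr0_norm ab); ring.
  rewrite ab1 mulr1.
  (* For opposite signs the difference term alone suffices: it equals [g], and
     [g >= h >= (h^-1 + A)^-1]. *)
  have PQ0 : 0 <= P + Q.
    by apply: le_trans CS; rewrite divr_ge0 ?sqr_ge0 // ltW.
  have hB : (h^-1 + A)^-1 <= h.
    by rewrite invf_ple ?posrE // lerDl.
  by have := hg; lra.
Qed.

Lemma eff_sparsity2_design : eff_sparsity2 X (S0 m0) = h^-1 + A.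
Proof.
rewrite /eff_sparsity2 compat2_design card_S0.
by rewrite invf_div mulrC divfK ?pnatr_eq0.
Qed.

(** Definiteness, the source of uniqueness for the Lasso: the three nonnegative parts of the form
    vanish separately, killing first the inactive coordinates, then the sum and the difference of
    the active ones. *)
Lemma design_inj (w : 'cV[R]_(2 + m0)) : norm2 (X *m w) ^+ 2 <= 0 -> w = 0.
Proof.
rewrite sqr_norm2_design.
set s := w (idx1 m0) 0 + _ + _.
set D := _ - _; set Q := \sum_k tau k * _.
have Q0 : 0 <= Q.
  by apply: sumr_ge0 => k _; rewrite mulr_ge0 ?sqr_ge0 // ltW.
have hs0 : 0 <= h * s ^+ 2 by rewrite mulr_ge0 ?sqr_ge0 // ltW.
have gD0 : 0 <= g * D ^+ 2 by rewrite mulr_ge0 ?sqr_ge0 // ltW.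
move=> le0.
have /eqP : Q = 0 by lra.
rewrite psumr_eq0 => [/allP w0|k _]; last by rewrite mulr_ge0 ?sqr_ge0 // ltW.
have wk k : w (idx2D k) 0 = 0.
  have := w0 k (mem_index_enum _).
  by rewrite /= mulf_eq0 (gt_eqF (tau0 k)) sqrf_eq0 => /eqP.
have /eqP : h * s ^+ 2 = 0 by lra.
rewrite mulf_eq0 (gt_eqF h0) sqrf_eq0 => /eqP se.
have /eqP : g * D ^+ 2 = 0 by lra.
rewrite mulf_eq0 (gt_eqF g0) sqrf_eq0 => /eqP De.
move: se; rewrite /s big1 => [se|k _]; last by rewrite wk mulr0.
have w1 : w (idx1 m0) 0 = 0 by move: De se; rewrite /D; lra.
have w2 : w (idx2 m0) 0 = 0 by move: De se; rewrite /D; lra.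
by apply/colP; elim/idx_ind => [||k]; rewrite mxE.
Qed.

(** * The noiseless Lasso solution and its error *)

Variables (beta0 : 'cV[R]_(2 + m0)) (lambda : R).
(** [hat] solves the stationarity equations with all signs positive. With
    [beta0 - hat = (delta, delta, - gam)], the active columns give [h * (2 * delta - \sum_k C k *
    gam k) = lambda], and column [idx2D k] then gives [C k * lambda - tau k * gam k = lambda]. *)
Let gam k := lambda * (C k - 1) / tau k.
Let delta := lambda / (1 - rho) + lambda * \sum_k C k * (C k - 1) / (2 * tau k).
Let hat := idx_col (beta0 (idx1 m0) 0 - delta) (beta0 (idx2 m0) 0 - delta) gam.

Hypotheses (lambda0 : 0 < lambda)
  (beta21 : beta0 (idx2 m0) 0 <= beta0 (idx1 m0) 0)
  (beta2 : delta <= beta0 (idx2 m0) 0)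
  (beta0C : forall k, beta0 (idx2D k) 0 = 0).

Let sum_gam : \sum_k C k * gam k = 2 * delta - lambda / h.
Proof.
rewrite /delta mulrDr.
have -> : 2 * (lambda / (1 - rho)) = lambda / h.
  by rewrite /h; field; rewrite gt_eqF ?subr_gt0.
rewrite addrC addKr !mulr_sumr; apply: eq_bigr => k _.
by rewrite /gam; field; rewrite gt_eqF.
Qed.

(** Nonnegativity makes the all-ones vector a subgradient of the l1 norm at [hat]; the bounds on
    [beta0] and [1 < C k] enter here. *)
Let hat_ge0 j : 0 <= hat j 0.
Proof.
elim/idx_ind: j => [||k].
- by rewrite idx_col1 subr_ge0 (le_trans beta2).
- by rewrite idx_col2 subr_ge0.
- rewrite idx_col2D /gam divr_ge0 ?mulr_ge0 //; try exact: ltW.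
  by have := hC1 k; lra.
Qed.

(* [X_j^T X (beta0 - hat) = lambda] for every [j], hence the linear term. *)
Lemma sqr_norm2_lasso (beta : 'cV[R]_(2 + m0)) :
  norm2 (X *m (beta - beta0)) ^+ 2 =
  norm2 (X *m (beta - hat)) ^+ 2 - 2 * lambda * \sum_j (beta - hat) j 0
  + lambda ^+ 2 * (h^-1 + \sum_k (C k - 1) ^+ 2 / tau k).
Proof.
set w := beta - hat.
have subE (u v : 'cV[R]_(2 + m0)) j : (u - v) j 0 = u j 0 - v j 0.
  by rewrite !mxE.
have e1 : (beta - beta0) (idx1 m0) 0 = w (idx1 m0) 0 - delta.
  by rewrite /w !subE idx_col1; ring.
have e2 : (beta - beta0) (idx2 m0) 0 = w (idx2 m0) 0 - delta.
  by rewrite /w !subE idx_col2; ring.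
have e3 k : (beta - beta0) (idx2D k) 0 = w (idx2D k) 0 + gam k.
  by rewrite /w !subE beta0C idx_col2D; ring.
rewrite !sqr_norm2_design e1 e2 big_idx.
under eq_bigr => k _ do rewrite e3 mulrDr.
rewrite big_split /= sum_gam.
(* The cross term is [2 * lambda * (C k - 1) * w_k]; its [C k] part cancels against the cross term
   of the square weighted by [h], leaving the plain coordinate sum of [w]. *)
have -> : \sum_k tau k * (beta - beta0) (idx2D k) 0 ^+ 2 =
    \sum_k tau k * w (idx2D k) 0 ^+ 2
    + 2 * lambda * (\sum_k C k * w (idx2D k) 0 - \sum_k w (idx2D k) 0)
    + lambda ^+ 2 * \sum_k (C k - 1) ^+ 2 / tau k.
  rewrite -sumrB !mulr_sumr -!big_split; apply: eq_bigr => k _ /=.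
  by rewrite e3 /gam; field; rewrite gt_eqF.
by field; rewrite gt_eqF.
Qed.

(** By the expansion above, the objective at [betastar] exceeds that at [hat] by
    [norm2 (X *m (betastar - hat)) ^+ 2] plus [2 * lambda] times the gap between the l1 norm and the
    coordinate sum of [betastar]. The gap is nonnegative, so minimality forces the squared norm to
    be at most 0. *)
Lemma noiseless_lasso_design (betastar : 'cV[R]_(2 + m0)) :
  noiseless_lasso X beta0 lambda betastar -> betastar = hat.
Proof.
move=> /(_ hat); rewrite /lasso_objective !sqr_norm2_lasso subrr mulmx0.
have -> : norm2 (0 : 'cV[R]_n) ^+ 2 = 0 by rewrite norm2_sqr /dot mulmx0 mxE.
have -> : \sum_j (0 : 'cV[R]_(2 + m0)) j 0 = 0.
  by rewrite big1 // => j _; rewrite mxE.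
have -> : \sum_j (betastar - hat) j 0 = \sum_j betastar j 0 - norm1 hat.
  rewrite /norm1 -sumrB; apply: eq_bigr => j _.
  by rewrite (ger0_norm (hat_ge0 j)) 2!mxE.
have : 2 * lambda * \sum_j betastar j 0 <= 2 * lambda * norm1 betastar.
  by rewrite ler_pM2l ?mulr_gt0 // ler_sum // => j _; rewrite ler_norm.
rewrite mulrBr => le1 le2.
by apply/eqP; rewrite -subr_eq0; apply/eqP/design_inj; lra.
Qed.

(** At [hat] only the constant of the expansion remains; adding the penalty [2 * lambda * gam k]
    combines termwise through [(C k - 1) ^+ 2 + 2 * (C k - 1) = C k ^+ 2 - 1]. *)
Lemma lasso_error_design :
  norm2 (X *m (hat - beta0)) ^+ 2
    + 2 * lambda * norm1 (subvec (~: S0 m0)%SET hat)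
  = lambda ^+ 2 * (h^-1 + A) - lambda ^+ 2 * \sum_k (1 / tau k).
Proof.
rewrite sqr_norm2_lasso subrr mulmx0 norm1_subvec_S0C.
have -> : norm2 (0 : 'cV[R]_n) ^+ 2 = 0 by rewrite norm2_sqr /dot mulmx0 mxE.
have -> : \sum_j (0 : 'cV[R]_(2 + m0)) j 0 = 0.
  by rewrite big1 // => j _; rewrite mxE.
rewrite mulr0 subr0 add0r !mulrDr -!addrA; congr (_ + _).
rewrite /A !mulr_sumr -sumrB -big_split; apply: eq_bigr => k _ /=.
have := hat_ge0 (idx2D k); rewrite idx_col2D => /ger0_norm ->.
by rewrite /gam; field; rewrite gt_eqF.
Qed.

End Design.

Theorem lemma11p1 (R : realType) (n m0 : nat) (hm0 : (1 <= m0)%N)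
  (X : 'M[R]_(n, 2 + m0)) (hX : fair_design X)
  (rho : R) (hrho : dot (col (idx1 m0) X) (col (idx2 m0) X) = - rho)
  (hrho0 : 0 < rho) (hrho1 : rho < 1)
  (varphi2 : R) (hvarphi2 : varphi2 = 1 - rho)
  (beta0 : 'cV[R]_(2 + m0)) (hbeta0 : active_set beta0 = S0 m0)
  (C : 'I_m0 -> R) (U : 'I_m0 -> 'cV[R]_n)
  (hXU : forall k, col (idx2D k) X =
     C k *: (2^-1 *: (col (idx1 m0) X + col (idx2 m0) X)) + U k)
  (hC1 : forall k, 1 < C k)
  (hC2 : forall k, C k ^+ 2 * varphi2 / 2 < 1)
  (hU1 : forall k, dot (U k) (col (idx1 m0) X) = 0)
  (hU2 : forall k, dot (U k) (col (idx2 m0) X) = 0)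
  (hUU : forall k j : 'I_m0, j != k -> dot (U k) (U j) = 0)
  (tau2 : 'I_m0 -> R)
  (htau2 : forall k, tau2 k = 1 - C k ^+ 2 * varphi2 / 2) :
  eff_sparsity2 X (S0 m0) = 2 / varphi2 + \sum_k C k ^+ 2 / tau2 k
  /\
  (forall lambda : R, 0 < lambda ->
     beta0 (idx2 m0) 0 <= beta0 (idx1 m0) 0 ->
     lambda / varphi2 + lambda * \sum_k (C k * (C k - 1) / (2 * tau2 k))
       <= beta0 (idx2 m0) 0 ->
     forall betastar : 'cV[R]_(2 + m0),
       noiseless_lasso X beta0 lambda betastar ->
       norm2 (X *m (betastar - beta0)) ^+ 2
         + 2 * lambda * norm1 (subvec (~: S0 m0)%SET betastar)
       = lambda ^+ 2 * eff_sparsity2 X (S0 m0)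
         - lambda ^+ 2 * \sum_k (1 / tau2 k)).
Proof.
subst varphi2; case: hX => unitX _.
have tau0 k : 0 < tau2 k by rewrite htau2 subr_gt0.
rewrite (eff_sparsity2_design unitX hrho hrho0 hrho1 hXU hC1 hU1 hU2 hUU htau2
  tau0); split; first by rewrite invf_div.
move=> lambda lambda0 b21 b2 betastar lasso.
have beta0C k : beta0 (idx2D k) 0 = 0.
  have := idx2D_S0 k; rewrite -hbeta0 inE => /negbFE/eqP; exact.
have -> := noiseless_lasso_design unitX hrho hrho0 hrho1 hXU hC1 hU1 hU2 hUU
  htau2 tau0 lambda0 b21 b2 beta0C lasso.
exact: (lasso_error_design unitX hrho hrho1 hXU hC1 hU1 hU2 hUU htau2 tau0
  lambda0 b21 b2 beta0C).
Qed.
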